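(* Let $G$ be a graph and let $\sigma$ be a cyclic order of $V(G)$. If $G$ admits a convex outside-obstacle representation (OOR) in which the clockwise cyclic order of the vertices along the convex hull is $\sigma$, then for every non-edge of $G$ there exists a candidate gap with respect to $\sigma$.
   Context: All graphs are finite and simple. Given a cyclic order $\sigma = \langle v_1,\dots,v_n\rangle$ of $V(G)$ and $i\ne j$, $[v_i,v_j]$ denotes the subsequence $\langle v_i, v_{i+1},\dots,v_j\rangle$ with indices modulo $n$. For an index $i$, the closed interval from $v_i$ to itself is just $\langle v_i\rangle$. A gap (with respect to $\sigma$) is a pair $g = vv'$ of vertices that are non-adjacent in $G$ and such that $v'$ is the immediate successor of $v$ in $\sigma$. Let $\bar e = xy$ be a non-edge of $G$ (a pair of distinct non-adjacent vertices), with its endpoints named such that $g$ lies between $x$ and $y$ with respect to $\sigma$, that is, going along $\sigma$ from $x$ to $y$ one passes $v$ and then directly $v'$, i.e. $[v,v'] \subseteq [x,y]$ (where $v=x$ and/or $v'=y$ is allowed). Then $g$ is a candidate gap for $\bar e$ if there is no edge of $G$ that connects a vertex in $[x,v]$ and a vertex in $[v',y]$. A straight-line drawing $\Gamma$ of a graph $G$ maps the vertices to pairwise distinct points of $\mathbb{R}^2$ and each edge to the closed line segment between its endpoints. The outer face of $\Gamma$ is the unbounded connected component of the complement in $\mathbb{R}^2$ of the union of all vertex points and edge segments. A non-edge is identified with the line segment between its endpoints. An outside-obstacle representation (OOR) of $G$ is a straight-line drawing of $G$ such that no edge segment contains a vertex point other than its two endpoints and every non-edge segment intersects the outer face of the drawing.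 (Equivalently, $G$ is the visibility graph of the point set with respect to a single obstacle, namely the open outer face of the drawing.) An OOR is convex if the vertex points are in convex position, i.e., each vertex point is a corner of the convex hull of all vertex points. *)

(* Defs.v *)
From HB Require Import structures.
From mathcomp Require Import all_boot all_order all_algebra.
From mathcomp Require Import all_classical all_reals all_analysis.

Set Implicit Arguments.
Unset Strict Implicit.
Unset Printing Implicit Defensive.

Import Order.TTheory GRing.Theory Num.Theory.
Import numFieldNormedType.Exports.

Local Open Scope classical_set_scope.
Local Open Scope ring_scope.

Section Combinatorics.
Context {V : finType}.
Implicit Types (e : rel V) (s : seq V) (x y v : V).

Definition simple_graph e : Prop := symmetric e /\ irreflexive e.

Definition nonedge e x y : bool := (x != y) && ~~ e x y.

(* A duplicate-free list of all vertices, read cyclically: only rotation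
   invariant data ([next s], [arc s]) of s are used below. *)
Definition cyclic_order s : Prop := uniq s /\ (forall v, v \in s).

(* The closed interval [x, y]; since [arc s x y] stops just before y,
   [cinterval s x x] is [:: x]. *)
Definition cinterval s x y : seq V := rcons (arc s x y) y.

Definition gap e s v (v' : V) : bool := nonedge e v v' && (v' == next s v).

(* Contiguity matters: for the gap from y to x (when y immediately precedes x),
   both its endpoints belong to [x, y], but it does not lie between x and y. *)
Definition gap_between s x y v (v' : V) : bool :=
  infix (cinterval s v v') (cinterval s x y).

Definition unblocked e s x y v (v' : V) : Prop :=
  forall u w, u \in cinterval s x v -> w \in cinterval s v' y -> ~~ e u w.

(* The non-edge is the unordered pair {x, y}; its endpoints are named in the
   order in which the gap lies between them. *)
Definition candidate_gap e s x y v (v' : V) : Prop :=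
  gap e s v v' /\
  ((gap_between s x y v v' /\ unblocked e s x y v v') \/
   (gap_between s y x v v' /\ unblocked e s y x v v')).

End Combinatorics.

Section Geometry.
Context {R : realType}.
Implicit Types (p q r : R * R) (A : set (R * R)).

Definition segment p q : set (R * R) :=
  [set (1 - t) *: p + t *: q | t in `[0, 1]].

Definition conv_hull A : set (R * R) :=
  smallest (@convex_set R (R * R)%type) A.

Definition corner A p : Prop :=
  A p /\ forall q r, A q -> A r -> segment q r p -> p = q \/ p = r.

(* Negative (with the second axis pointing upwards) iff r lies strictly to the
   right of the directed line from p to q. *)
Definition orient p q r : R :=
  (q.1 - p.1) * (r.2 - p.2) - (q.2 - p.2) * (r.1 - p.1).

End Geometry.

Section Drawings.
Context {R : realType} {V : finType}.
Implicit Types (e : rel V) (pos : V -> R * R) (s : seq V).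

Definition drawing_set e pos : set (R * R) :=
  range pos `|`
  \bigcup_(uv in [set uv : V * V | e uv.1 uv.2]) segment (pos uv.1) (pos uv.2).

(* [connected_component C p] is empty when p is not in C.  The drawing is
   compact, so its complement has exactly one unbounded component. *)
Definition outer_face e pos : set (R * R) :=
  [set p | ~ bounded_set (connected_component (~` drawing_set e pos) p)].

Definition straight_line_drawing pos : Prop := injective pos.

Definition outside_obstacle_rep e pos : Prop :=
  [/\ straight_line_drawing pos,
      (forall u v w, e u v -> segment (pos u) (pos v) (pos w) ->
         w = u \/ w = v) &
      (forall u v, nonedge e u v ->
         (segment (pos u) (pos v) `&` outer_face e pos) !=set0)].

Definition convex_position pos : Prop :=
  forall v, corner (conv_hull (range pos)) (pos v).

(* Meaningful for points in convex position: going from each vertex to its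
   successor follows a side of the convex hull, with the hull on the right. *)
Definition clockwise_along_hull pos s : Prop :=
  forall u w, w != u -> w != next s u ->
    orient (pos u) (pos (next s u)) (pos w) < 0.

Definition convex_OOR e pos : Prop :=
  outside_obstacle_rep e pos /\ convex_position pos.

End Drawings.

(* Main.v *)
(** List the vertices clockwise as f 0 = x, f 1, ..., f n = x, with y = f k, and
    let p be a point of the segment xy.  If no candidate gap exists, then every
    side f i, f (i+1) of the hull is cut off from p by an edge f a, f b of G with
    a <= i < b, lying on one side of xy.  The points of the hull lying, for every
    i, strictly on the inner side of the i-th such edge form an open bounded set.
    Replacing the strict inequalities by weak ones gives a closed set which
    differs from it only by points of the drawing: a hull point on the line of an
    edge belongs to that edge.  So the component of p in the complement of the
    drawing is trapped in a bounded set, and p is not on the outer face. *)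
Require Import Defs.
From mathcomp Require Import all_boot all_order all_algebra.
From mathcomp Require Import all_classical all_reals all_analysis.
From mathcomp Require Import ring lra zify.

Set Implicit Arguments.
Unset Strict Implicit.
Unset Printing Implicit Defensive.

Import Order.TTheory GRing.Theory Num.Theory.
Import numFieldNormedType.Exports.

Local Open Scope classical_set_scope.
Local Open Scope ring_scope.

(** * Orientation of triples of points in the plane *)

Section Orient.
Context {R : realType}.
Implicit Types p q r a b c : R * R.

Lemma scale_addE (a b : R) p q :
  a *: p + b *: q = (a * p.1 + b * q.1, a * p.2 + b * q.2).
Proof. by []. Qed.

Lemma orient_rot p q r : orient p q r = orient q r p.
Proof. by rewrite /orient; ring. Qed.

Lemma orient_swap p q r : orient p q r = - orient q p r.
Proof. by rewrite /orient; ring. Qed.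

Lemma orient_diag p q : orient p q p = 0.
Proof. by rewrite /orient; ring. Qed.

Lemma orient_affine p q a b (t : R) :
  orient p q ((1 - t) *: a + t *: b) =
  (1 - t) * orient p q a + t * orient p q b.
Proof. by rewrite scale_addE /orient /=; ring. Qed.

Lemma orient_segment_le0 p q a b c :
  orient p q a <= 0 -> orient p q b <= 0 -> segment a b c ->
  orient p q c <= 0.
Proof.
move=> ha hb [t /=]; rewrite in_itv /= => /andP[t0 t1] <-.
by rewrite orient_affine; nra.
Qed.

(* Around [o], clockwise order is transitive inside the
   half-plane to the right of [o n]. *)
Lemma orient_trans o n a b c :
  orient o n a <= 0 -> orient o n b < 0 -> orient o n c < 0 ->
  orient o a b < 0 -> orient o b c < 0 -> orient o a c < 0.
Proof.
move=> na nb nc ab bc.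
have pluecker : orient o n b * orient o a c =
    orient o n a * orient o b c + orient o n c * orient o a b.
  by rewrite /orient; ring.
have : 0 < orient o n b * orient o a c.
  rewrite pluecker; apply: ltr_wpDl; last by rewrite nmulr_lgt0.
  by apply: mulr_le0 => //; exact: ltW.
by rewrite nmulr_rgt0.
Qed.

Lemma orient_eq0_line p q r : p != q -> orient p q r = 0 ->
  exists t : R, r = (1 - t) *: p + t *: q.
Proof.
case: p q r => [p1 p2] [q1 q2] [r1 r2]; rewrite /orient /= => pq h.
have [e1|e1] := eqVneq q1 p1.
  have e2 : q2 - p2 != 0.
    by apply: contra_neq pq => /subr0_eq ->; rewrite e1.
  exists ((r2 - p2) / (q2 - p2)); rewrite scale_addE /=.
  congr pair; last by field.
  rewrite e1; have : (q2 - p2) * (r1 - p1) = 0 by rewrite e1 in h; lra.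
  by move/eqP; rewrite mulf_eq0 (negbTE e2) /= => /eqP /subr0_eq ->; ring.
have {}e1 : q1 - p1 != 0 by rewrite subr_eq0.
exists ((r1 - p1) / (q1 - p1)); rewrite scale_addE /=.
congr pair; first by field.
apply: (mulfI e1); apply: (addIr (- ((q1 - p1) * p2))).
have -> : (q1 - p1) * r2 - (q1 - p1) * p2 = (q2 - p2) * (r1 - p1) by lra.
by field.
Qed.

Lemma continuous_orient p q : continuous (orient p q : R * R -> R^o).
Proof.
move=> r; rewrite /orient.
apply: cvgB; apply: cvgM; try exact: cvg_cst.
- by apply: cvgB; [exact: cvg_snd|exact: cvg_cst].
- by apply: cvgB; [exact: cvg_fst|exact: cvg_cst].
Qed.

(** The three orientations at [q], divided by [orient a b c], are the barycentric coordinates of [q]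
    in the triangle. The signs make them nonnegative, so [q] is a convex combination of points of
    the ball of radius [M]. *)
Lemma norm_triangle_le a b c q (M : R) :
  `|a| <= M -> `|b| <= M -> `|c| <= M ->
  orient a b c < 0 -> orient a b q <= 0 -> orient b c q <= 0 ->
  orient c a q <= 0 -> `|q| <= M.
Proof.
move=> aM bM cM D hab hbc hca.
have D0 : orient a b c != 0 by rewrite lt_eqF.
set D' := orient a b c in D D0 *.
pose al := orient b c q / D'; pose be := orient c a q / D'.
pose ga := orient a b q / D'.
have al0 : 0 <= al by apply: mulr_le0 => //; rewrite invr_le0 ltW.
have be0 : 0 <= be by apply: mulr_le0 => //; rewrite invr_le0 ltW.
have ga0 : 0 <= ga by apply: mulr_le0 => //; rewrite invr_le0 ltW.
have s1 : al + be + ga = 1.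
  rewrite /al /be /ga -!mulrDl.
  have -> : orient b c q + orient c a q + orient a b q = D'.
    by rewrite /D' /orient; ring.
  by rewrite divff.
have -> : q = al *: a + be *: b + ga *: c.
  have E : D' *: q = orient b c q *: a + orient c a q *: b + orient a b q *: c.
    rewrite /D' /orient.
    case: (q) (a) (b) (c) => [q1 q2] [a1 a2] [b1 b2] [c1 c2] /=.
    by rewrite scale_addE; congr pair => /=; rewrite /GRing.scale /=; ring.
  apply: (scalerI D0); rewrite E !scalerDr !scalerA /al /be /ga.
  by rewrite !(mulrC D') !divfK.
rewrite (le_trans (ler_normD _ _))// (le_trans (lerD (ler_normD _ _) (lexx _)))//.
clearbody al be ga; have -> : M = al * M + be * M + ga * M by rewrite -!mulrDl s1 mul1r.
rewrite !normrZ (ger0_norm al0) (ger0_norm be0) (ger0_norm ga0).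
by apply: lerD; first apply: lerD; rewrite ler_wpM2l.
Qed.

End Orient.

(** The part of [C] where all [g i] are negative is open in [C]. By the third hypothesis it is also
    the part where all are nonpositive, hence closed in [C]; it contains [p], so it is all of
    [C]. *)
Lemma connected_trapped {T : topologicalType} {R : realType} (I : finType)
    (g : I -> T -> R^o) (C : set T) (p : T) :
  connected C -> (forall i, continuous (g i)) ->
  (forall q, C q -> (forall i, g i q <= 0) -> forall i, g i q < 0) ->
  C p -> (forall i, g i p <= 0) -> C `<=` [set q | forall i, g i q < 0].
Proof.
move=> Cc gc sharp Cp hp.
suff <- : C `&` [set q | forall i, g i q < 0] = C by move=> q [].
apply: Cc.
- by exists p; split => //; exact: sharp.
- exists [set q | forall i, g i q < 0] => //.
  rewrite openE => q hq /=; apply: filter_forall => i.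
  have : nbhs (g i q) [set z : R^o | z < 0].
    by apply: open_nbhs_nbhs; split; [exact: open_lt|exact: hq].
  exact: gc.
- exists (\bigcap_(i in [set: I]) (g i @^-1` [set z : R^o | z <= 0])).
    apply: closed_bigI => i _; apply: closed_comp; last exact: closed_le.
    by move=> q _; exact: gc.
  apply/seteqP; split => q [Cq h]; split => //.
    by move=> i _; apply/ltW/h.
  by apply: sharp => // i; exact: h.
Qed.

(** * Cyclic intervals in terms of positions in the list *)

Section Cyclic.
Context {V : finType} (x : V) (s' : seq V).
Let s := x :: s'.
Let n := size s.
(* The default value [x] makes [f n] the first vertex again, so that [i < n]
   enumerates all consecutive pairs [f i], [f i.+1], including the closing one. *)
Let f := nth x s.
Hypothesis Us : uniq s.

Lemma nth_size_head : f n = x.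
Proof. by rewrite /f nth_default. Qed.

Lemma next_nth_succ i : (i < n)%N -> next s (f i) = f i.+1.
Proof.
move=> ltin; transitivity (nth x s' (index (f i) s)); last by rewrite index_uniq.
by rewrite next_nth mem_nth.
Qed.

Lemma nth_inj i j : (i < n)%N -> (j < n)%N -> f i = f j -> i = j.
Proof. by move=> li lj /eqP; rewrite nth_uniq// => /eqP. Qed.

(** Taking [b = n] describes an interval that wraps around to end at [x]. The bound [b - a < n]
    excludes the full turn from [0] to [n], where [f a = f b] and the interval is the single vertex
    [x]. *)
Lemma cinterval_nth a b : (a <= b <= n)%N -> (b - a < n)%N ->
  cinterval s (f a) (f b) = [seq f j | j <- iota a (b - a).+1].
Proof.
move=> /andP[leab lebn] ltn.
rewrite -addn1 iotaD map_cat /= subnKC// cats1 /cinterval; congr rcons.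
rewrite map_nth_iota ?leq_sub2r//.
have [an|an] := ltnP a n; last first.
  have -> : a = n by lia.
  have -> : b = n by lia.
  by rewrite nth_size_head subnn take0 /arc /= eqxx rot0 /= eqxx.
rewrite /arc [index (f a) s]index_uniq//.
suff -> : index (f b) (rot a s) = (b - a)%N.
  rewrite /rot take_cat size_drop ltn_neqAle leq_sub2r// andbT.
  case: eqVneq => // ->.
  by rewrite subnn take0 cats0 take_oversize// size_drop.
have Ur : uniq (rot a s) by rewrite rot_uniq.
have -> : f b = nth x (rot a s) (b - a).
  rewrite /rot nth_cat size_drop nth_drop subnKC//.
  case: ltnP => // h; have -> : b = n by lia.
  by rewrite nth_size_head subnn; case: a an {leab ltn Ur h}.
by apply: index_uniq; rewrite ?size_rot//; exact: ltn.
Qed.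

Lemma mem_cinterval_nth a b u : (a <= b <= n)%N -> (b - a < n)%N ->
  u \in cinterval s (f a) (f b) -> exists2 j, (a <= j <= b)%N & u = f j.
Proof.
move=> ab ltn; rewrite cinterval_nth// => /mapP[j].
by rewrite mem_iota => h ->; exists j => //; lia.
Qed.

Lemma gap_between_nth a b i : (a <= i < b)%N -> (b <= n)%N -> (b - a < n)%N ->
  gap_between s (f a) (f b) (f i) (f i.+1).
Proof.
move=> aib bn ltn; rewrite /gap_between !cinterval_nth; try lia.
apply/infixP; exists [seq f j | j <- iota a (i - a)],
  [seq f j | j <- iota i.+2 (b - i.+1)].
rewrite -!map_cat; congr map.
have -> : (b - a).+1 = ((i - a) + ((i.+1 - i).+1 + (b - i.+1)))%N by lia.
by rewrite !iotaD subnKC ?(andP aib).1//; congr (_ ++ (_ ++ iota _ _)); lia.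
Qed.

Lemma unblockedPn (e : rel V) a b i :
  (a <= i < b)%N -> (b <= n)%N -> (b - a < n)%N ->
  ~ unblocked e s (f a) (f b) (f i) (f i.+1) ->
  exists j l, [/\ (a <= j <= i)%N, (i < l <= b)%N & e (f j) (f l)].
Proof.
move=> aib bn ltn; apply: contra_notP => hN u w.
move=> /mem_cinterval_nth[|| j hj ->]; try lia.
move=> /mem_cinterval_nth[|| l hl ->]; try lia.
by apply/negP => ejl; apply: hN; exists j, l; split.
Qed.

End Cyclic.

(** Rotating a duplicate-free list changes neither [next] nor [arc], so the list may be made to
    start at an endpoint of the non-edge. *)
Lemma candidate_gap_rot {V : finType} (e : rel V) (s : seq V) m x y v v' :
  cyclic_order s -> candidate_gap e (rot m s) x y v v' ->
  candidate_gap e s x y v v'.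
Proof.
move=> [Us sT]; rewrite /candidate_gap /gap /gap_between /unblocked next_rot//.
have cE a b : cinterval (rot m s) a b = cinterval s a b.
  by rewrite /cinterval arc_rot.
by rewrite !cE.
Qed.

(** * The convex polygon, its sides and its chords *)

Section Hull.
Context {R : realType} {V : finType} (pos : V -> R * R) (x : V) (s' : seq V).
Let s := x :: s'.
Let n := size s.
Let f := nth x s.
Hypothesis Us : uniq s.
Hypothesis sT : forall v, v \in s.
Hypothesis cw : clockwise_along_hull pos s.

Let o i j q := orient (pos (f i)) (pos (f j)) q.

Definition in_hull (q : R * R) :=
  forall i, (i < n)%N -> o i i.+1 q <= 0.

Let next_f i : (i < n)%N -> next s (f i) = f i.+1.
Proof. exact: next_nth_succ. Qed.

Let f_inj i j : (i < n)%N -> (j < n)%N -> f i = f j -> i = j.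
Proof. exact: nth_inj. Qed.

Let f_n : f n = f 0%N.
Proof. exact: nth_size_head. Qed.

Lemma nth_surj v : exists2 i, (i < n)%N & v = f i.
Proof. by exists (index v s); rewrite ?index_mem// /f nth_index. Qed.

Lemma orient_side_lt0 i j :
  (i.+1 < n)%N -> (j < n)%N -> j != i -> j != i.+1 ->
  o i i.+1 (pos (f j)) < 0.
Proof.
move=> li lj ji ji1; rewrite /o -(next_f (ltnW li)); apply: cw.
  by apply: contra_neq ji => /(f_inj lj (ltnW li)).
by rewrite (next_f (ltnW li)); apply: contra_neq ji1 => /(f_inj lj li).
Qed.

(** Induction on [l]: all vertices lie to the right of the side leaving [f i], so around [f i] the
    turns from [f j] to [f l] and from [f l] to [f l.+1] compose by [orient_trans]. *)
Lemma orient_lt0 i j l : (i < j < l)%N -> (l < n)%N ->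
  o i j (pos (f l)) < 0.
Proof.
move=> /andP[lij]; elim: l => // l IH ljl ln.
have [->|jl] := eqVneq j l.
  by rewrite /o orient_rot; apply: orient_side_lt0; lia.
apply: (@orient_trans _ _ (pos (f i.+1)) _ (pos (f l))).
- have [->|ji] := eqVneq j i.+1; last by apply/ltW/orient_side_lt0; lia.
  by rewrite -orient_rot orient_diag.
- by apply: orient_side_lt0; lia.
- by apply: orient_side_lt0; lia.
- by apply: IH; lia.
- by rewrite /o orient_rot; apply: orient_side_lt0; lia.
Qed.

Lemma orient_le0 i j l : (i <= j <= l)%N -> (l <= n)%N ->
  o i j (pos (f l)) <= 0.
Proof.
move=> /andP[lij ljl] ln.
have [->|ij] := eqVneq i j; first by rewrite /o orient_rot orient_diag.
have [->|jl] := eqVneq j l; first by rewrite /o -orient_rot orient_diag.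
have {ln} [ln|ln] : (l = n \/ l < n)%N by lia.
  rewrite ln /o f_n; case: i lij ij => [|i] lij ij; first by rewrite orient_diag.
  by rewrite -orient_rot; apply/ltW/(@orient_lt0 0); lia.
by apply/ltW/orient_lt0; lia.
Qed.

Lemma orient_side_le0 i j : (i < n)%N -> (j <= n)%N ->
  o i i.+1 (pos (f j)) <= 0.
Proof.
move=> li lj; have [h|h] := leqP j i.
  by rewrite /o -orient_rot; apply: orient_le0; lia.
by apply: orient_le0; lia.
Qed.

Lemma in_hull_segment u v q : segment (pos u) (pos v) q -> in_hull q.
Proof.
have [i li ->] := nth_surj u; have [j lj ->] := nth_surj v => h l ll.
by apply: orient_segment_le0 h; apply: orient_side_le0 => //; exact: ltnW.
Qed.

(** The side leaving [u] works unless it ends at [w]; then the side entering [u] does. *)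
Lemma side_through u w : (exists z, z != u /\ z != w) -> u != w ->
  exists i, [/\ (i < n)%N, o i i.+1 (pos u) = 0 & o i i.+1 (pos w) < 0].
Proof.
move=> [z [zu zw]] uw.
have [i li E] := nth_surj u.
have [wn|wn] := eqVneq w (next s u); last first.
  exists i; split => //; first by rewrite /o E orient_diag.
  by rewrite /o -(next_f li) -E; apply: cw => //; rewrite eq_sym.
have [k lk uk] : exists2 k, (k < n)%N & u = f k.+1.
  case: i li E => [|i] li E; last by exists i => //; exact: ltnW.
  by exists n.-1; rewrite ?prednK// E f_n.
exists k; split => //; first by rewrite /o uk -orient_rot orient_diag.
rewrite /o -(next_f lk); apply: cw; last first.
  by rewrite (next_f lk) -uk eq_sym.
(* If [w] also preceded [u], the third vertex [z] would lie strictly to the right of both [u w] and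
   [w u]. *)
apply/eqP => wk.
have wu : next s w = u by rewrite wk (next_f lk).
have h1 : orient (pos u) (pos w) (pos z) < 0.
  by rewrite wn; apply: cw; rewrite -?wn.
have h2 : orient (pos w) (pos u) (pos z) < 0.
  by rewrite -wu; apply: cw; rewrite ?wu.
by move: h1; rewrite orient_swap oppr_lt0 ltNge (ltW h2).
Qed.

(** A side through [u] with [w] strictly inside forces [0 <= t]; a side through [w] with [u]
    strictly inside forces [t <= 1]. *)
Lemma hull_line_segment u w q : injective pos ->
  (exists z, z != u /\ z != w) -> u != w ->
  in_hull q -> orient (pos u) (pos w) q = 0 -> segment (pos u) (pos w) q.
Proof.
move=> inj z3 uw hq /orient_eq0_line[|t qE].
  by apply: contra_neq uw => /inj.
exists t => //=; rewrite in_itv /=; apply/andP; split.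
  have [i [li i0 iw]] := side_through z3 uw.
  have := hq i li.
  by rewrite /o qE orient_affine [orient _ _ (pos u)]i0 mulr0 add0r nmulr_lle0.
have z3' : exists z, z != w /\ z != u by case: z3 => z [zu zw]; exists z.
have wu : w != u by rewrite eq_sym.
have [i [li i0 iw]] := side_through z3' wu.
have := hq i li; rewrite /o qE orient_affine [orient _ _ (pos w)]i0 mulr0 addr0.
by rewrite nmulr_lle0// subr_ge0.
Qed.

(* An interior point lies in a triangle of the fan from [f 0]. *)
Lemma hull_interior_bounded :
  bounded_set [set q | forall i, (i < n)%N -> o i i.+1 q < 0].
Proof.
exists (\sum_v `|pos v|); split=> [|M /ltW leM q hq]; first exact: num_real.
rewrite /= (le_trans _ leM)//.
have posM v : `|pos v| <= \sum_v `|pos v|.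
  by rewrite (bigD1 v)//= lerDl sumr_ge0.
(* The least such [j] is the first ray from [f 0] that does not leave [q] strictly on its right; the
   closing side shows that [n - 1] qualifies. *)
have ex : exists j, (0 < j < n)%N && (0 <= o 0 j q).
  have [m nE] : exists m, n = m.+1 by exists (size s').
  have ltmn : (m < n)%N by rewrite nE.
  have := hq m ltmn; rewrite /o -nE f_n => h.
  exists m; rewrite ltmn andbT /o orient_swap oppr_ge0 ltW// andbT.
  rewrite lt0n; apply: contraTneq h => ->.
  by rewrite orient_rot orient_diag ltxx.
case: (ex_minnP ex) => -[//|j] /andP[/= ltjn oj] min.
have j0 : (0 < j)%N.
  by rewrite lt0n; apply: contraTneq oj => ->; rewrite -ltNge; exact: hq.
have oj0 : o 0 j q < 0.
  rewrite ltNge; apply/negP => h.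
  have := min j; rewrite j0 h (ltnW ltjn) => /(_ isT).
  by rewrite ltnn.
apply: (norm_triangle_le (posM (f 0%N)) (posM (f j)) (posM (f j.+1))).
- by apply: orient_lt0; rewrite ?j0/=.
- exact: ltW.
- by apply/ltW/hq; exact: ltnW.
- by rewrite orient_swap oppr_le0.
Qed.

Lemma third_vertex (u w : V) : (2 < n)%N -> exists z, z != u /\ z != w.
Proof.
move=> n3; apply: contrapT => h; move: n3; rewrite ltnNge => /negP; apply.
apply: (@uniq_leq_size _ s [:: u; w]) => // z _; rewrite !inE.
by apply/negPn/negP; rewrite negb_or => /andP[zu zw]; apply: h; exists z.
Qed.

Lemma separated_not_outer (e : rel V) (a b : nat -> nat) (p : R * R) :
  irreflexive e -> injective pos -> (2 < n)%N -> in_hull p ->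
  (forall i, (i < n)%N ->
     [/\ (a i <= i < b i)%N, (b i <= n)%N, e (f (a i)) (f (b i)) &
         o (a i) (b i) p <= 0]) ->
  ~ outer_face e pos p.
Proof.
move=> eI inj n3 hp chord; rewrite /outer_face /=.
set C := connected_component _ p; apply.
(* On the drawing itself the component of [p] is empty, hence bounded. *)
have [Dp|Dp] := pselect (drawing_set e pos p).
  by rewrite /C connected_component_out; [exists 0; split => // M _ q []|exact].
pose g (k : bool * 'I_n) (q : R * R) : R^o :=
  if k.1 then o k.2 k.2.+1 q else o (a k.2) (b k.2) q.
suff Cg : C `<=` [set q | forall k, g k q < 0].
  have [M0 [M0_real hM]] := hull_interior_bounded.
  exists M0; split=> // M ltM q Cq; apply: (hM M ltM q) => i li.
  exact: (Cg q Cq (true, Ordinal li)).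
apply: (connected_trapped (p := p)).
- exact: component_connected.
- by move=> [[] i]; exact: continuous_orient.
- move=> q Cq gq.
  have Dq : ~ drawing_set e pos q by exact: connected_component_sub Cq.
  have hq : in_hull q by move=> i li; exact: (gq (true, Ordinal li)).
  have cq (i : 'I_n) : o (a i) (b i) q < 0.
    have [_ _ eab _] := chord i (ltn_ord i).
    rewrite lt_neqAle (gq (false, i)) andbT; apply/eqP => q0.
    apply: Dq; right; exists (f (a i), f (b i)) => //=.
    apply: hull_line_segment q0 => //; first exact: third_vertex.
    by apply: contraTneq eab => ->; rewrite eI.
  case=> -[] i; rewrite /g /=; last exact: cq.
  (* A side need not be an edge. But both its ends lie weakly beyond the chord from [f (a i)] to
     [f (b i)], so a point of the side would contradict [cq]. *)
  rewrite lt_neqAle hq// andbT; apply/eqP => q0.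
  have : segment (pos (f i)) (pos (f i.+1)) q.
    apply: hull_line_segment q0 => //; first exact: third_vertex.
    apply/eqP => ii; have := ltn_ord i; rewrite leq_eqVlt => /orP[/eqP iE|lti].
      by rewrite iE f_n in ii; have := f_inj (ltn_ord i) _ ii; lia.
    by have := f_inj (ltn_ord i) lti ii; lia.
  have [abi bn _ _] := chord i (ltn_ord i).
  move=> qs; have := cq i; rewrite /o orient_swap oppr_lt0 ltNge => /negP; apply.
  by apply: orient_segment_le0 qs; rewrite orient_rot; apply: orient_le0; lia.
- exact: connected_component_refl.
- case=> -[] i; rewrite /g /=; first exact: hp.
  by have [] := chord i (ltn_ord i).
Qed.

End Hull.

(** * From missing candidate gaps to separating edges *)

Lemma candidate_gap_exists {R : realType} {V : finType} (e : rel V)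
    (pos : V -> R * R) x s' y :
  simple_graph e -> cyclic_order (x :: s') -> convex_OOR e pos ->
  clockwise_along_hull pos (x :: s') -> nonedge e x y ->
  exists v v', candidate_gap e (x :: s') x y v v'.
Proof.
move=> [eS eI] [Us sT] [[inj _ vis] _] cw xy.
apply: contrapT => noc.
set s := x :: s' in Us sT cw noc *.
pose n := size s; pose f := nth x s.
have f0 : f 0%N = x by [].
have fn : f n = x by exact: nth_size_head.
have [k ltkn yE] := nth_surj sT y.
rewrite -/s -/n -/f in ltkn yE.
have k0 : (0 < k)%N.
  by rewrite lt0n; apply: contraTneq xy => k0; rewrite /nonedge yE k0 f0 eqxx.
have [p [pxy outp]] := vis _ _ xy.
have hp : in_hull pos x s' p by exact: in_hull_segment pxy.
(* The last clause keeps both ends of the edge on one side of [x y]. The bound on [i] sits inside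
   the existential so that [choice] yields a total function; [(0, 0)] is a dummy value. *)
have edge i : exists jl : nat * nat, (i < n)%N ->
    [/\ (jl.1 <= i < jl.2)%N, (jl.2 <= n)%N, e (f jl.1) (f jl.2) &
        (jl.2 <= k)%N || (k <= jl.1)%N].
  have [li|] := ltnP i n; last by exists (0, 0)%N.
  (* A side that is an edge cuts itself off. *)
  have [eii|eii] := boolP (e (f i) (f i.+1)).
    by exists (i, i.+1) => _; split => //=; lia.
  have gi : gap e s (f i) (f i.+1).
    rewrite /gap /nonedge eii andbT (next_nth_succ Us li) eqxx andbT.
    apply/eqP => ii; move: li; rewrite leq_eqVlt => /orP[/eqP iE|lti].
      rewrite iE fn -f0 in ii.
      by have := nth_inj Us _ _ ii; rewrite -/n; lia.
    by have := nth_inj Us _ lti ii; rewrite -/n; lia.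
  (* Positions [0] to [k] run from [x] to [y], positions [k] to [n] from [y] back to [x = f n]. *)
  have [ik|ki] := ltnP i k.
    have [|||h|j [l [ji il ejl]]] := @unblockedPn _ x s' Us e 0 k i; rewrite -?/s -?/n; try lia.
      apply: noc; exists (f i), (f i.+1); split => //; left; split.
        by rewrite -f0 yE; apply: gap_between_nth; rewrite -/s -/n; lia.
      by rewrite yE; exact: h.
    by exists (j, l) => _; split => //=; lia.
  have [|||h|j [l [ji il ejl]]] := @unblockedPn _ x s' Us e k n i; rewrite -?/s -?/n; try lia.
    apply: noc; exists (f i), (f i.+1); split => //; right; split.
      by rewrite -fn yE; apply: gap_between_nth; rewrite -/s -/n; lia.
    by rewrite yE -fn; exact: h.
  by exists (j, l) => _; split => //=; lia.
(* With only two vertices, the edge cutting off side [0] would be [x y] itself. *)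
have n3 : (2 < n)%N.
  rewrite ltnNge; apply/negP => n2.
  have [[j l] /= /(_ (ltn_trans k0 ltkn))[ji jn ejl jk]] := edge 0%N.
  have jE : j = 0%N by lia.
  have lE : l = k by lia.
  by move: xy; rewrite /nonedge yE -f0 -jE -lE ejl andbF.
have [ab abP] := choice edge.
apply: (@separated_not_outer _ _ pos x s' Us sT cw e
          (fun i => (ab i).1) (fun i => (ab i).2)) outp => // i li.
have [aib bn eab abk] := abP i li; split=> //.
(* Both [x] and [y] lie weakly on the inner side of the chord, hence so does [p]. *)
apply: orient_segment_le0 pxy; rewrite -/s -/f.
  by rewrite -f0 -orient_rot; apply: orient_le0 => //; rewrite -/n; lia.
rewrite yE; case/orP: abk => [bk|ka].
  by apply: orient_le0 => //; rewrite -/n; lia.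
by rewrite -orient_rot; apply: orient_le0 => //; rewrite -/n; lia.
Qed.

Theorem lemma4 (R : realType) (V : finType) (e : rel V) (s : seq V)
    (e_graph : simple_graph e) (s_cyclic : cyclic_order s) :
  (exists pos : V -> (R * R)%type,
     convex_OOR e pos /\ clockwise_along_hull pos s) ->
  forall x y : V, nonedge e x y -> exists v v' : V, candidate_gap e s x y v v'.
Proof.
move=> [pos [oor cw]] x y xy; have [Us sT] := s_cyclic.
have [m s' sE] := rot_to (sT x).
have s'_cyclic : cyclic_order (x :: s').
  by rewrite -sE; split=> [|v]; rewrite ?rot_uniq ?mem_rot.
have cw' : clockwise_along_hull pos (x :: s').
  by move=> u w; rewrite -sE next_rot//; exact: cw.
have [v [v' cg]] := candidate_gap_exists e_graph s'_cyclic oor cw' xy.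
by exists v, v'; apply: (candidate_gap_rot s_cyclic (m := m)); rewrite sE.
Qed.
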